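(* Let $\mathcal{G}=(V,\mathcal{E})$ be a temporal graph, let $\mathtt{b}^{(\star)}_v$ denote the $(\star)$-temporal betweenness centrality of $v\in V$, and let $\mathcal{F}=\{\widetilde{\mathtt{b}}^{(\star)}_v : v\in V\}$ be a set of functions from a domain $\mathcal{D}$, equipped with a probability distribution $\pi$, to $[0,1]$, where $\widetilde{\mathtt{b}}^{(\star)}_v$ is an unbiased estimator of $\mathtt{b}^{(\star)}_v$, i.e. $\mathbf{E}_\pi[\widetilde{\mathtt{b}}^{(\star)}_v]=\mathtt{b}^{(\star)}_v$, for every $v\in V$. Define $\hat v\in(0,1/4]$ and $\rho^{(\star)}\ge 0$ such that $\max_{v\in V}\mathrm{Var}_\pi(\widetilde{\mathtt{b}}^{(\star)}_v)\le \hat v$ and $\sum_{v\in V}\mathtt{b}^{(\star)}_v\le\rho^{(\star)}$. Fix $\varepsilon,\delta\in(0,1)$, and let $\mathcal{S}$ be an i.i.d. sample taken from $\mathcal{D}$ (according to $\pi$) of size $$|\mathcal{S}|\in O\!\left(\frac{\hat v+\varepsilon}{\varepsilon^2}\,\ln\!\left(\frac{\rho^{(\star)}}{\delta\hat v}\right)\right).$$ Then $SD(\mathcal{F},\mathcal{S})\le\varepsilon$ with probability $1-\delta$ over $\mathcal{S}$.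
   Context: The $O(\cdot)$ is the order of a sufficient sample size: a number of samples of this order, with an absolute constant, suffices for the conclusion. Supremum deviation: for a family $\mathcal F$ of functions $\mathcal D\to[0,1]$, a distribution $\pi$ on $\mathcal D$ and a sample $\mathcal S=\{s_1,\dots,s_r\}$, $SD(\mathcal F,\mathcal S)=\sup_{f\in\mathcal F}\left|\frac1r\sum_{i=1}^r f(s_i)-\mathbf E_\pi[f]\right|$. A (directed) temporal graph is $\mathcal G=(V,\mathcal E)$ with $V$ finite, $n=|V|$, and $\mathcal E$ a finite set of temporal edges $(u,v,t)$, $u,v\in V$, $t\in T=\{1,\dots,|T|\}$. A temporal path from $s$ to $z\ne s$ is a sequence of vertex appearances $((u_1,t_1),\dots,(u_k,t_k))$ with $u_1=s$, $u_k=z$, $t_1=0$, $t_i<t_{i+1}$ and $(u_i,u_{i+1},t_{i+1})\in\mathcal E$ for $1\le i\le k-1$. Its length is $k-1$ and its arrival time is $t_k$; it is foremost if no temporal path from $s$ to $z$ arrives earlier (the trivial path from $s$ to itself arrives at time $0$). The symbol $(\star)$ denotes one of the following optimality criteria: shortest (minimum length among temporal paths from $s$ to $z$), shortest-foremost (minimum length among foremost temporal paths from $s$ to $z$), prefix-foremost (foremost, and every prefix is foremost). Let $\sigma^{(\star)}_{sz}$ be the number of $(\star)$-optimal temporal paths from $s$ to $z$ and $\sigma^{(\star)}_{sz}(v)$ the number of those that pass through $v$, $s\neq v\neq z$. The $(\star)$-temporal betweenness of $v$ is $\mathtt b^{(\star)}_v=\frac1{n(n-1)}\sum_{s\ne v\ne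 z,\ s\ne z}\frac{\sigma^{(\star)}_{sz}(v)}{\sigma^{(\star)}_{sz}}$, where terms with $\sigma^{(\star)}_{sz}=0$ are $0$.
   Formalization: The logarithmic factor in the sample size is taken as max(1, ln(ρ/(δ v̂))), since for ρ close to or below δ v̂ the bare expression is arbitrarily small or negative and no absolute constant multiple of it suffices. *)

(* Defs.v *)
From HB Require Import structures.
From mathcomp Require Import all_boot all_order all_algebra.
From mathcomp Require Import all_classical all_reals all_analysis.

Set Implicit Arguments.
Unset Strict Implicit.
Unset Printing Implicit Defensive.

Import Order.TTheory GRing.Theory Num.Theory.
Import numFieldNormedType.Exports.

Local Open Scope classical_set_scope.
Local Open Scope ring_scope.

(* Edges carry times in {1, ..., tg_horizon}; the value 0 of the time type is
   kept for the starting appearance of a path. *)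
Record temporal_graph (V : finType) := TemporalGraph {
  tg_horizon : nat ;
  tg_edges : {set V * V * 'I_tg_horizon.+1} ;
  tg_edge_time : forall e, e \in tg_edges -> (0 < e.2)%N }.

Section TemporalPaths.
Variables (V : finType) (G : temporal_graph V).
Implicit Types (s z v : V).

Definition appearance : finType := (V * 'I_(tg_horizon G).+1)%type.

Implicit Type p : seq appearance.

Definition tg_step (a b : appearance) : bool :=
  (a.2 < b.2)%N && ((a.1, b.1, b.2) \in tg_edges G).

Definition endpoint s p : V := last s (map fst p).

Definition arrival p : nat := last 0%N (map (fun a : appearance => a.2 : nat) p).

Definition path_length p : nat := (size p).-1.

(* For s = z this also accepts the trivial path [:: (s, 0)]. *)
Definition temporal_path s z p : bool :=
  if p is a :: p' then
    [&& a.1 == s, a.2 == 0%N :> nat, path tg_step a p' & endpoint s p == z]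
  else false.

(* Times strictly increase along a path, so the following finite type
   contains all temporal paths (see size_temporal_path). *)
Definition path_space : finType := ((tg_horizon G).+1.-bseq appearance)%type.

Lemma size_temporal_path s z p :
  temporal_path s z p -> (size p <= (tg_horizon G).+1)%N.
Proof.
case: p => // a p /and4P[_ _ ap _].
suff H b q : path tg_step b q -> (b.2 + size q <= tg_horizon G)%N.
  by rewrite /= ltnS; apply: leq_trans (leq_addl _ _) (H _ _ ap).
elim: q b => [|c q IH] b /=; first by rewrite addn0 -ltnS ltn_ord.
move=> /andP[/andP[bc _] /IH]; apply: leq_trans.
by rewrite addnS -addSn leq_add2r.
Qed.

Definition shortest s z p : bool :=
  temporal_path s z p &&
  [forall q : path_space,
     temporal_path s z q ==> (path_length p <= path_length q)%N].

Definition foremost s z p : bool :=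
  temporal_path s z p &&
  [forall q : path_space, temporal_path s z q ==> (arrival p <= arrival q)%N].

Definition shortest_foremost s z p : bool :=
  foremost s z p &&
  [forall q : path_space,
     foremost s z q ==> (path_length p <= path_length q)%N].

Definition prefix_foremost s z p : bool :=
  foremost s z p &&
  [forall i : 'I_(size p), foremost s (endpoint s (take i.+1 p)) (take i.+1 p)].

End TemporalPaths.

Variant criterion := Shortest | ShortestForemost | PrefixForemost.

Definition optimal (V : finType) (G : temporal_graph V) (star : criterion)
    (s z : V) (p : seq (appearance G)) : bool :=
  match star with
  | Shortest => shortest s z p
  | ShortestForemost => shortest_foremost s z p
  | PrefixForemost => prefix_foremost s z p
  end.

Definition sigma (V : finType) (G : temporal_graph V) (star : criterion)
    (s z : V) : nat :=
  #|[set p : path_space G | optimal star s z p]|.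

(* Only used for s != v and v != z. *)
Definition sigma_through (V : finType) (G : temporal_graph V) (star : criterion)
    (s z v : V) : nat :=
  #|[set p : path_space G | optimal star s z p & v \in map fst p]|.

(* A term with sigma = 0 vanishes because x / 0 = 0. *)
Definition temporal_betweenness (R : realType) (V : finType)
    (G : temporal_graph V) (star : criterion) (v : V) : R :=
  (#|V|%:R * (#|V|%:R - 1))^-1 *
  \sum_(s : V) \sum_(z : V | [&& s != v, v != z & s != z])
    (sigma_through G star s z v)%:R / (sigma G star s z)%:R.

(* For an empty family this is sup set0 = 0. *)
Definition supremum_deviation (R : realType) (d : measure_display)
    (D : measurableType d) (pi : probability D R)
    (F : set (D -> R)) (r : nat) (x : 'I_r -> D) : R :=
  sup [set `| r%:R^-1 * \sum_(i < r) f (x i) - fine 'E_pi[f] | | f in F].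

Definition mutually_independent (R : realType)
    (dO d : measure_display) (Omega : measurableType dO) (D : measurableType d)
    (P : probability Omega R) (r : nat) (X : 'I_r -> {RV P >-> D}) : Prop :=
  forall (J : {set 'I_r}) (A : 'I_r -> set D),
    (forall i, measurable (A i)) ->
    P (\bigcap_(i in [set` J]) X i @^-1` A i) =
    (\prod_(i in J) P (X i @^-1` A i))%E.

Definition iid_sample (R : realType)
    (dO d : measure_display) (Omega : measurableType dO) (D : measurableType d)
    (P : probability Omega R) (pi : probability D R)
    (r : nat) (X : 'I_r -> {RV P >-> D}) : Prop :=
  mutually_independent X /\
  forall (i : 'I_r) (A : set D), measurable A -> distribution P (X i) A = pi A.

(* The expression inside the O(.) of the sample size.  As usual in such bounds
   the logarithmic factor is read as max(1, ln _).  Without this floor the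
   expression can be arbitrarily small or negative (rho close to or below
   delta * vhat), and no multiple of it is then a sufficient sample size.
   It is the bare expression as soon as rho / (delta * vhat) >= e. *)
Definition sample_order (R : realType) (vhat rho eps delta : R) : R :=
  (vhat + eps) / eps ^+ 2 * Num.max 1 (ln (rho / (delta * vhat))).

(* Main.v *)
(* Write b_v for the mean and V_v for the variance of the v-th function.  Since
   the functions take values in [0, 1], V_v <= b_v, so V_v <= s where s is
   min(vhat, b_v), or an arbitrarily small positive number if b_v = 0.
   Chernoff's method with a parameter adapted to s gives
     P(|empirical mean - b_v| > eps) <= 2 exp(- K (1 + ln (vhat / s)))
   with K = r eps^2 / (8 (vhat + eps)).  As soon as K >= 1 this is at most
   2 (s / vhat) e^-K.  Hence it is at most 2 (b_v / vhat) e^-K, and the union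
   bound over v costs only the factor rho / vhat, whatever the number of
   vertices. *)

Require Import Defs.
From HB Require Import structures.
From mathcomp Require Import all_boot all_order all_algebra.
From mathcomp Require Import all_classical all_reals all_analysis.
From mathcomp Require Import measurable_realfun ring lra.

Set Implicit Arguments.
Unset Strict Implicit.
Unset Printing Implicit Defensive.

Import Order.TTheory GRing.Theory Num.Theory.
Import numFieldNormedType.Exports.

Local Open Scope classical_set_scope.
Local Open Scope ring_scope.

(** * Real inequalities behind the Chernoff exponent *)

(** For [u = lambda * y], the bound [1 - u <= expR (- u)] gives [expR u - 1 <= u * expR u]. If
    [u >= 0], the remainder [expR u - 1 - u] is then at most [u * (expR u - 1) <= u ^+ 2 * expR u].
    If [u < 0], it is at most [u * (expR u - 1) <= u ^+ 2] because [u <= expR u - 1]. Both are at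
    most [expR lambda * u ^+ 2]. *)
Lemma expR_le1DxDsqr (R : realType) (lambda y : R) : 0 <= lambda -> `|y| <= 1 ->
  expR (lambda * y) <= 1 + lambda * y + lambda ^+ 2 * expR lambda * y ^+ 2.
Proof.
move=> l0 /[!ler_norml] /andP[y1 y2]; set u := lambda * y.
have -> : lambda ^+ 2 * expR lambda * y ^+ 2 = expR lambda * u ^+ 2.
  by rewrite /u; ring.
have uexp : expR u - 1 <= u * expR u.
  have /(ler_wpM2r (expR_ge0 u)) := expR_ge1Dx (- u).
  rewrite mulrDl mul1r expRN mulVf ?expR_eq0// mulNr; lra.
have el1 : 1 <= expR lambda by rewrite -expR0 ler_expR.
have ul : expR u <= expR lambda.
  rewrite ler_expR /u -[leRHS]mulr1; exact: ler_wpM2l.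
have lb := expR_ge1Dx u; have epos := expR_gt0 u.
have [u0|u0] := leP 0 u; nra.
Qed.

Lemma expR_quarter_le (R : realType) : expR (4^-1 : R) <= 4 / 3.
Proof.
have := expR_ge1Dx (- 4^-1 : R); rewrite expRN => h.
rewrite -[leLHS]invrK -[leRHS]invrK lef_pV2 ?posrE ?invr_gt0 ?expR_gt0//; lra.
Qed.

(* [lambda] is [eps / (4 s)] in the Gaussian regime [eps <= s], and
   [(1 + ln (eps / s)) / 4] in the Poisson regime [s < eps]. *)
Lemma chernoff_exponent (R : realType) (s v eps : R) :
  0 < s -> s <= v -> 0 < eps ->
  exists2 lambda : R, 0 < lambda &
    s * (lambda ^+ 2 * expR lambda) - lambda * eps <=
    - (8^-1 * (eps ^+ 2 / (v + eps)) * (1 + ln (v / s))).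
Proof.
move=> s0 sv e0; have v0 : 0 < v by exact: lt_le_trans sv.
have q := expR_quarter_le R.
have [es|se] := leP eps s.
- exists (eps / (4 * s)); first by rewrite divr_gt0// mulr_gt0.
  set l := eps / (4 * s).
  have lE : eps = 4 * s * l by rewrite /l; field; rewrite gt_eqF.
  have l0 : 0 < l by rewrite /l divr_gt0// mulr_gt0.
  have l4 : l <= 4^-1 by rewrite /l ler_pdivrMr ?mulr_gt0//; lra.
  have el : expR l <= 4 / 3 by apply: le_trans q; rewrite ler_expR.
  have ln_le : 1 + ln (v / s) <= v / s.
    have := @le_ln1Dx R (v / s - 1); rewrite addrCA subrr addr0.
    have : 0 < v / s by rewrite divr_gt0.
    by move=> vs /(_ _); lra.
  (* The logarithm costs at most a factor [v / s], which turns the rate for [v] into the rate for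
     [s]. *)
  have rhs : eps ^+ 2 / (v + eps) * (1 + ln (v / s)) <= eps ^+ 2 / s.
    apply: (@le_trans _ _ (eps ^+ 2 / v * (v / s))).
      apply: ler_pM => //.
      + by rewrite divr_ge0 ?sqr_ge0//; lra.
      + by rewrite addr_ge0// ln_ge0// ler_pdivlMr// mul1r.
      + rewrite ler_wpM2l ?sqr_ge0// lef_pV2 ?posrE ?lerDl//; lra.
    by rewrite mulrA divfK ?gt_eqF.
  rewrite lerNr -[leLHS]mulrA; apply: (@le_trans _ _ (8^-1 * (eps ^+ 2 / s))).
    by rewrite ler_wpM2l.
  have -> : eps ^+ 2 / s = 16 * s * l ^+ 2.
    by rewrite lE; field; rewrite gt_eqF.
  (* After the substitution [eps = 4 * s * l], the left side is [s * l ^+ 2 * (expR l - 4)], at most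
     [- (8 / 3) * s * l ^+ 2], while the target is [- 2 * s * l ^+ 2]. *)
  rewrite lE; have := ler_wpM2l (ltW (mulr_gt0 s0 (exprn_gt0 2 l0))) el; nra.
- set L := ln (eps / s).
  have eLs : s * expR L = eps.
    by rewrite /L lnK ?posrE ?divr_gt0// mulrC divfK// gt_eqF.
  have L0 : 0 < L by rewrite /L ln_gt0// ltr_pdivlMr// mul1r.
  exists ((1 + L) / 4); first by rewrite divr_gt0//; lra.
  (* Split [ln (v / s)] as [ln (v / eps) + L]. If [v <= eps], the first term is nonpositive.
     Otherwise [1 + ln (v / eps) <= v / eps], and this factor is absorbed by [eps ^+ 2 / v]. *)
  have rhs : eps ^+ 2 / (v + eps) * (1 + ln (v / s)) <= eps * (1 + L).
    have -> : ln (v / s) = ln (v / eps) + L.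
      by rewrite /L -lnM ?posrE ?divr_gt0// mulrA divfK// gt_eqF.
    have [ve|ev] := leP v eps.
      have lnv : ln (v / eps) <= 0 by rewrite ln_le0// ler_pdivrMr// mul1r.
      have h1 : eps ^+ 2 / (v + eps) <= eps.
        rewrite ler_pdivrMr; nra.
      have h0 : 0 <= eps ^+ 2 / (v + eps).
        by rewrite divr_ge0 ?sqr_ge0//; lra.
      nra.
    have lnv : 1 + ln (v / eps) <= v / eps.
      have := @le_ln1Dx R (v / eps - 1); rewrite addrCA subrr addr0.
      have : 0 < v / eps by rewrite divr_gt0.
      by move=> vs /(_ _); lra.
    have ve1 : 1 <= v / eps by rewrite ler_pdivlMr// mul1r ltW.
    apply: (@le_trans _ _ (eps ^+ 2 / v * (v / eps * (1 + L)))).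
      apply: ler_pM => //.
      + by rewrite divr_ge0 ?sqr_ge0//; lra.
      + by have := ln_ge0 ve1; lra.
      + rewrite ler_wpM2l ?sqr_ge0// lef_pV2 ?posrE ?lerDl//; lra.
      + nra.
    rewrite le_eqVlt; apply/orP; left; apply/eqP.
    by field; rewrite !gt_eqF.
  rewrite lerNr -[leLHS]mulrA; apply: (@le_trans _ _ (8^-1 * (eps * (1 + L)))).
    by rewrite ler_wpM2l.
  (* [K] is the part of [expR L] left over by [expR ((1 + L) / 4)], up to the constant [expR 4^-1].
     Since it dominates [3 / 4 * (1 + L)], [E * (1 + L)] is at most [4 / 3 * expR 4^-1 * eps], hence
     at most [16 / 9 * eps]. *)
  set K := expR (3 / 4 * L).
  have K1 : 3 / 4 * (1 + L) <= K.
    by have := expR_ge1Dx (3 / 4 * L); rewrite -/K; lra.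
  have EK : s * expR ((1 + L) / 4) * K = expR (4^-1) * eps.
    rewrite -eLs /K -mulrA -expRD.
    rewrite (_ : (1 + L) / 4 + 3 / 4 * L = 4^-1 + L); last by field.
    by rewrite expRD mulrCA.
  set E := s * expR ((1 + L) / 4) in EK *.
  have E0 : 0 <= E by rewrite mulr_ge0 ?expR_ge0// ltW.
  have h : E * (1 + L) <= 16 / 9 * eps by nra.
  have -> : s * (((1 + L) / 4) ^+ 2 * expR ((1 + L) / 4)) =
      (E * (1 + L)) * (1 + L) / 16.
    by rewrite /E; field.
  (* The quadratic term is at most [eps * (1 + L) / 9] and the linear one is [- eps * (1 + L) / 4].
     Their sum is at most [- 5 / 36 * eps * (1 + L)], and [5 / 36 >= 1 / 8]. *)
  nra.
Qed.

(** * Expectation of a product over an i.i.d. sample *)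

Section IndependentProduct.
Context (R : realType) (dO d : measure_display).
Context (Omega : measurableType dO) (D : measurableType d).

Import HBNNSimple.

(** Passage from indicators to nonnegative measurable functions, by linearity on simple functions
    and then monotone convergence. The weight [H] stands for the product of the factors at the other
    indices, and [c] for its expectation. *)
Lemma ge0_integral_comp_weighted (P : {measure set Omega -> \bar R})
    (mu : {measure set D -> \bar R}) (X : Omega -> D) (H : Omega -> R) (c : R)
    (g : D -> \bar R) :
  measurable_fun setT X -> measurable_fun setT H -> (forall w, 0 <= H w) ->
  0 <= c ->
  (forall A, measurable A ->
    (\int[P]_w ((\1_A (X w))%:E * (H w)%:E) = c%:E * mu A)%E) ->
  measurable_fun setT g -> (forall x, 0 <= g x)%E ->
  (\int[P]_w (g (X w) * (H w)%:E) = c%:E * \int[mu]_x g x)%E.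
Proof.
move=> mX mH H0 c0 PA mg g0.
pose f_ := nnsfun_approx measurableT mg.
have ndf x m n : (m <= n)%N -> (f_ m x <= f_ n x)%R.
  by move=> mn; exact/lefP/nd_nnsfun_approx.
have cvf x : (f_ n x)%:E @[n --> \oo] --> g x.
  by apply: cvg_nnsfun_approx => // y _; exact: g0.
have mf n : measurable_fun setT (fun w => (f_ n (X w))%:E * (H w)%:E)%E.
  apply: emeasurable_funM; apply/measurable_EFinP => //.
  by apply: (measurableT_comp _ mX); exact: measurable_funP.
have simple n : (\int[P]_w ((f_ n (X w))%:E * (H w)%:E) =
    c%:E * \int[mu]_x (f_ n x)%:E)%E.
  have mk k : measurable (f_ n @^-1` [set k]) by exact: measurable_funPTI.
  rewrite integralT_nnsfun sintegralE ge0_mule_fsumr; last first.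
    by move=> k; exact: nnsfun_mulemu_ge0.
  have m1 k : measurable_fun setT
      (fun w => (\1_(f_ n @^-1` [set k]) (X w))%:E * (H w)%:E)%E.
    apply: emeasurable_funM; apply/measurable_EFinP => //.
    exact: (measurableT_comp (measurable_indic (mk k)) mX).
  transitivity (\int[P]_w (\sum_(k \in range (f_ n))
      (k%:E * ((\1_(f_ n @^-1` [set k]) (X w))%:E * (H w)%:E))))%E.
    apply: eq_integral => w _; rewrite fimfunE -fsumEFin// muleC.
    rewrite ge0_mule_fsumr; last by move=> k; exact: nnfun_muleindic_ge0.
    by apply: eq_fsbigr => k _; rewrite muleC EFinM muleA.
  rewrite ge0_integral_fsum//; last 2 first.
  - by move=> k; apply: emeasurable_funM => //; exact: measurable_cst.
  - move=> k w _; rewrite muleA mule_ge0// ?lee_fin//.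
    exact: nnfun_muleindic_ge0.
  apply: eq_fsbigr => k; rewrite inE => -[y _ <-].
  rewrite ge0_integralZl_EFin//; last by move=> w _; rewrite mule_ge0 ?lee_fin.
  by rewrite PA// muleCA.
have lhs : (\int[P]_w ((f_ n (X w))%:E * (H w)%:E) @[n --> \oo] -->
    \int[P]_w (g (X w) * (H w)%:E))%E.
  rewrite (_ : (fun w => _) =
      fun w => limn (fun n => (f_ n (X w))%:E * (H w)%:E))%E.
    apply: cvg_monotone_convergence => //.
    - by move=> n w _; rewrite mule_ge0 ?lee_fin.
    - by move=> w _ m n mn; rewrite lee_wpmul2r ?lee_fin ?ndf.
  by apply/funext => w; apply/esym/cvg_lim => //; exact: cvgeZr.
have rhs : (c%:E * \int[mu]_x (f_ n x)%:E @[n --> \oo] -->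
    c%:E * \int[mu]_x g x)%E.
  apply: cvgeZl => //; rewrite (_ : g = fun x => limn (fun n => (f_ n x)%:E)).
    apply: cvg_monotone_convergence => //.
    - by move=> n; exact/measurable_EFinP/measurable_funP.
    - by move=> n x _; rewrite lee_fin.
    - by move=> x _ m n mn; rewrite lee_fin ndf.
  by apply/funext => x; apply/esym/cvg_lim.
apply: (cvg_unique _ lhs) => //.
by rewrite /= (funext simple).
Qed.

Lemma integral_prod_independent (P : probability Omega R)
    (pi : probability D R) (r : nat) (X : 'I_r -> {RV P >-> D})
    (g : 'I_r -> D -> R) :
  iid_sample pi X ->
  (forall i, measurable_fun setT (g i)) -> (forall i x, 0 <= g i x) ->
  (forall i, \int[pi]_x (g i x)%:E < +oo)%E ->
  (\int[P]_w (\prod_(i < r) g i (X i w))%:E =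
   \prod_(i < r) \int[pi]_x (g i x)%:E)%E.
Proof.
move=> [Xind Xpi].
(* Indicators are replaced by general functions one index at a time: only the indices in [s] may
   carry a function that is not an indicator. The empty [s] is the definition of independence, the
   full enumeration is the claim. *)
suff H (s : seq 'I_r) (h : 'I_r -> D -> R) :
    (forall i, measurable_fun setT (h i)) ->
    (forall i x, 0 <= h i x) ->
    (forall i, \int[pi]_x (h i x)%:E < +oo)%E ->
    (forall i, i \notin s -> exists2 A, measurable A & h i = \1_A) ->
    (\int[P]_w (\prod_(i < r) h i (X i w))%:E =
     \prod_(i < r) \int[pi]_x (h i x)%:E)%E.
  by move=> mg g0 goo; apply: (H (enum 'I_r)) => // i; rewrite mem_enum.
elim: s h => [|k s IH] h mh h0 hoo hs.
  have /all_sig2[A mA hA] : forall i, {A | measurable A & h i = \1_A}.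
    by move=> i; apply: cid2; exact: hs.
  transitivity (P (\bigcap_(i in [set` [set: 'I_r]%SET]) X i @^-1` A i)).
    rewrite -[X in _ = P X]setIT -integral_indic//; last first.
      by apply: fin_bigcap_measurable => // i _; exact: measurable_funPTI.
    apply: eq_integral => w _; congr EFin; rewrite indicE.
    under eq_bigr do rewrite hA indicE.
    have [wA|wA] := boolP (w \in _); rewrite /=.
      rewrite big1// => i _; rewrite mem_set//.
      by move: wA; rewrite inE; apply; rewrite /= inE.
    move: wA; rewrite notin_setE => /existsNP[i /not_implyP[_ wAi]].
    by rewrite (bigD1 i)//= memNset ?mul0r.
  rewrite Xind//; apply: eq_big => [i|i _]; first by rewrite inE.
  rewrite hA integral_indic// setIT; exact: (Xpi i _ (mA i)).
(* The factor at [k] is separated from the others, whose product becomes the weight. Finiteness of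
   the integrals makes [c] a real constant. *)
pose H w := \prod_(i < r | i != k) h i (X i w).
have mH : measurable_fun setT H.
  rewrite /H; under eq_fun do rewrite -big_filter.
  apply: measurable_prod => i _.
  by apply: measurableT_comp => //; exact: measurable_funP.
have H0 w : 0 <= H w by apply: prodr_ge0.
pose c := (\prod_(i < r | i != k) \int[pi]_x (h i x)%:E)%E.
have cfin : c \is a fin_num.
  apply: prode_fin_num => i _; rewrite ge0_fin_numE ?hoo//.
  by apply: integral_ge0 => x _; rewrite lee_fin.
have c0 : (0 <= c)%E.
  apply: prode_ge0 => i _.
  by apply: integral_ge0 => x _; rewrite lee_fin.
rewrite [RHS](bigD1 k)//= -/c muleC -(fineK cfin).
rewrite -(@ge0_integral_comp_weighted P pi (X k) H) ?fine_ge0//.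
- by apply: eq_integral => w _; rewrite (bigD1 k).
- move=> A mA; rewrite fineK//.
  (* With an indicator put at [k], only the indices in [s] remain unrestricted, so the induction
     hypothesis applies and yields the weighted identity for indicators. *)
  pose h' i := if i == k then \1_A else h i.
  have h'k : h' k = \1_A by rewrite /h' eqxx.
  have h'N i : i != k -> h' i = h i by rewrite /h' => /negbTE ->.
  have := IH h'; rewrite [X in _ = X](bigD1 k)//= h'k.
  rewrite integral_indic// setIT muleC.
  rewrite (eq_bigr (fun i => \int[pi]_x (h i x)%:E)%E); last first.
    by move=> i /h'N ->.
  move=> <-.
  + apply: eq_integral => w _; rewrite (bigD1 k)//= h'k EFinM.
    congr (_ * _%:E)%E.
    by apply: eq_bigr => i /h'N ->.
  + by move=> i; rewrite /h'; case: ifP => // _; exact: measurable_indic.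
  + by move=> i x; rewrite /h'; case: ifP.
  + move=> i; rewrite /h'; case: ifP => // _; rewrite integral_indic// setIT.
    by rewrite (le_lt_trans (probability_le1 _ _)) ?ltry.
  + move=> i si; have [->|ik] := eqVneq i k; first by exists A.
    by rewrite h'N//; apply: hs; rewrite inE negb_or ik.
- exact/measurable_EFinP.
- by move=> x; rewrite lee_fin.
Qed.

End IndependentProduct.

(** * Chernoff bounds for the empirical mean *)

Section SampleDeviation.
Context (R : realType) (dO d : measure_display).
Context (Omega : measurableType dO) (D : measurableType d).
Context (P : probability Omega R) (pi : probability D R).

Lemma integrable_norm_le (f : D -> R) (M : R) :
  measurable_fun setT f -> (forall x, `|f x| <= M) ->
  pi.-integrable setT (EFin \o f).
Proof.
move=> mf fM; apply: measurable_bounded_integrable => //.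
  by rewrite (le_lt_trans (probability_le1 _ _)) ?ltry.
exists M; split; first exact: num_real.
by move=> N MN x _ /=; exact: le_trans (ltW MN).
Qed.

(** Integrating [expR_le1DxDsqr] kills the linear term and leaves [1 + K * s], which is at most
    [expR (s * K)]. *)
Lemma mgf_centered_le (Y : D -> R) (s lambda : R) :
  measurable_fun setT Y -> (forall x, `|Y x| <= 1) ->
  (\int[pi]_x (Y x)%:E = 0)%E -> (\int[pi]_x (Y x ^+ 2)%:E <= s%:E)%E ->
  0 <= lambda ->
  (\int[pi]_x (expR (lambda * Y x))%:E <=
   (expR (s * (lambda ^+ 2 * expR lambda)))%:E)%E.
Proof.
move=> mY Y1 EY EY2 l0; set K := lambda ^+ 2 * expR lambda.
have K0 : 0 <= K by rewrite mulr_ge0 ?sqr_ge0 ?expR_ge0.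
have mY2 : measurable_fun setT (fun x => Y x ^+ 2) by exact: measurable_funX.
have i1 : pi.-integrable setT (EFin \o (fun x => 1 + lambda * Y x)).
  apply: (@integrable_norm_le _ (1 + lambda)).
    by apply: measurable_funD => //; exact: measurable_funM.
  move=> x; rewrite (le_trans (ler_normD _ _))// normr1 lerD2l normrM.
  by rewrite ger0_norm// ler_piMr.
have i1c : pi.-integrable setT (EFin \o (fun _ : D => 1)).
  by apply: (@integrable_norm_le _ 1) => // x; rewrite normr1.
have i1l : pi.-integrable setT (EFin \o Y) by exact: (@integrable_norm_le _ 1).
have i1l' : pi.-integrable setT (EFin \o (fun x => lambda * Y x)).
  exact: (integrableZl measurableT lambda i1l).
have i2 : pi.-integrable setT (EFin \o (fun x => Y x ^+ 2)).
  apply: (@integrable_norm_le _ 1) => // x.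
  by rewrite normrX expr_le1.
have i2' : pi.-integrable setT (EFin \o (fun x => K * Y x ^+ 2)).
  exact: (integrableZl measurableT K i2).
apply: (@le_trans _ _ (\int[pi]_x (1 + lambda * Y x + K * Y x ^+ 2)%:E)%E).
  apply: ge0_le_integral => //.
  - apply/measurable_EFinP; apply: measurableT_comp => //.
    exact: measurable_funM.
  - apply/measurable_EFinP; apply: measurable_funD.
      by apply: measurable_funD => //; exact: measurable_funM.
    exact: measurable_funM.
  - by move=> x _; rewrite lee_fin expR_le1DxDsqr.
have -> : (\int[pi]_x (1 + lambda * Y x + K * Y x ^+ 2)%:E =
    1 + K%:E * \int[pi]_x (Y x ^+ 2)%:E)%E.
  have -> : (K%:E * \int[pi]_x (Y x ^+ 2)%:E = \int[pi]_x (K * Y x ^+ 2)%:E)%E.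
    by rewrite -integralZl.
  have EY' : (\int[pi]_x (lambda * Y x)%:E = 0)%E.
    under eq_integral do rewrite EFinM.
    by rewrite (integralZl _ i1l)// EY mule0.
  rewrite (integralD_EFin _ i1 i2')//= (integralD_EFin _ i1c i1l')//= EY' adde0.
  by rewrite integral_cst//= probability_setT mule1.
apply: (@le_trans _ _ (1 + K * s)%:E); last first.
  by rewrite lee_fin [s * K]mulrC expR_ge1Dx.
by rewrite EFinD (EFinM K s) leeD2l// lee_wpmul2l.
Qed.

(** Markov's inequality for the exponential. Each factor [g] carries its share [eps] of the
    threshold, so the product of the factors is at least 1 on the event. Independence turns its
    expectation into an [r]-th power. *)
Lemma iid_sum_gt_le (r : nat) (X : 'I_r -> {RV P >-> D}) (Y : D -> R)
    (s lambda eps : R) :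
  iid_sample pi X -> measurable_fun setT Y -> (forall x, `|Y x| <= 1) ->
  (\int[pi]_x (Y x)%:E = 0)%E -> (\int[pi]_x (Y x ^+ 2)%:E <= s%:E)%E ->
  0 <= lambda ->
  (P [set w | (r%:R * eps < \sum_(i < r) Y (X i w))%R] <=
   (expR (r%:R * (s * (lambda ^+ 2 * expR lambda) - lambda * eps)))%:E)%E.
Proof.
move=> iid mY Y1 EY EY2 l0; set K := lambda ^+ 2 * expR lambda.
pose g x := expR (lambda * (Y x - eps)).
have gE x : g x = expR (lambda * Y x) * expR (- (lambda * eps)).
  by rewrite /g mulrBr expRD.
have mgf : (\int[pi]_x (g x)%:E <= (expR (s * K - lambda * eps))%:E)%E.
  under eq_integral do rewrite gE EFinM.
  rewrite ge0_integralZr//.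
    by rewrite expRD EFinM lee_wpmul2r ?lee_fin ?expR_ge0// mgf_centered_le.
  apply/measurable_EFinP; apply: measurableT_comp => //.
  exact: measurable_funM.
have mg : measurable_fun setT g.
  apply: measurableT_comp => //; apply: measurable_funM => //.
  exact: measurable_funB.
have mYX i : measurable_fun setT (fun w => Y (X i w)).
  by apply: measurableT_comp => //; exact: measurable_funP.
set A := [set w | _].
have mA : measurable A.
  rewrite /A -[X in measurable X]setTI.
  apply: (measurable_fun_ltr (measurable_cst _) (measurable_sum _ _)) => //.
apply: (@le_trans _ _ (\int[P]_w (\prod_(i < r) g (X i w))%:E)%E).
  rewrite -[A]setIT -integral_indic//; apply: ge0_le_integral => //.
  - by apply/measurable_EFinP; exact: measurable_indic.
  - by apply/measurable_EFinP; apply: measurable_prod => i _;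
      apply: measurableT_comp => //; exact: measurable_funP.
  move=> w _; rewrite lee_fin indicE.
  have [|_] := boolP (w \in A); last first.
    by apply: prodr_ge0 => i _; exact: expR_ge0.
  rewrite inE /A /= => Aw; rewrite /g -expR_sum -expR0 ler_expR -mulr_sumr.
  rewrite mulr_ge0// big_split/= sumr_const card_ord -mulr_natl mulrN subr_ge0.
  exact: ltW.
rewrite (integral_prod_independent (g := fun=> g) iid) => [| |i x|i];
  last 3 first.
- by move=> _; exact: mg.
- exact: expR_ge0.
- exact: le_lt_trans mgf (ltry _).
have mgf0 : (0 <= \int[pi]_x (g x)%:E)%E.
  by apply: integral_ge0 => x _; rewrite lee_fin expR_ge0.
have mgf_fin : (\int[pi]_x (g x)%:E)%E \is a fin_num.
  by rewrite ge0_fin_numE// (le_lt_trans mgf)// ltry.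
move: mgf0 mgf; rewrite -(fineK mgf_fin) !lee_fin => mgf0 mgf.
rewrite prodEFin lee_fin prodr_const card_ord expRM_natl.
by rewrite lerXn2r ?nnegrE// expR_ge0.
Qed.

(** Since [f ^+ 2 <= f] on [0, 1], the integrand [(f - b) ^+ 2] is at most
    [(1 - 2 * b) * f + b ^+ 2], whose mean is [b - b ^+ 2]. *)
Lemma variance_le_mean (f : {RV pi >-> R}) (b : R) :
  (forall x, 0 <= f x <= 1) -> ('E_pi[f] = b%:E)%E -> ('V_pi[f] <= b%:E)%E.
Proof.
move=> f01 Ef; have mf : measurable_fun setT f by exact: measurable_funP.
have fle1 x : `|f x| <= 1 by have /andP[f0 f1] := f01 x; rewrite ger0_norm.
have ifr : pi.-integrable setT (EFin \o f) by exact: (@integrable_norm_le _ 1).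
have ifr' : pi.-integrable setT (EFin \o (fun x => (1 - 2 * b) * f x)).
  exact: (integrableZl measurableT (1 - 2 * b) ifr).
have ib : pi.-integrable setT (EFin \o (fun _ : D => b ^+ 2)).
  exact: (@integrable_norm_le _ `|b ^+ 2|).
rewrite /variance unlock Ef/= unlock.
apply: (@le_trans _ _ (\int[pi]_x ((1 - 2 * b) * f x + b ^+ 2)%:E)%E).
  apply: ge0_le_integral => //.
  - by move=> x _; rewrite lee_fin; exact: sqr_ge0.
  - by apply/measurable_EFinP; apply: measurable_funM; exact: measurable_funB.
  - apply/measurable_EFinP; apply: measurable_funD => //.
    exact: measurable_funM.
  - move=> x _; rewrite lee_fin.
    change ((f x - b) * (f x - b) <= (1 - 2 * b) * f x + b ^+ 2).
    have /andP[f0 f1] := f01 x; nra.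
rewrite (integralD_EFin _ ifr' ib)//= integral_cst//= probability_setT mule1.
under eq_integral do rewrite EFinM.
rewrite (integralZl _ ifr)//.
move: Ef; rewrite unlock => ->.
rewrite -EFinM -EFinD lee_fin; have := sqr_ge0 b; lra.
Qed.

Lemma iid_mean_deviation_le_variance (r : nat) (X : 'I_r -> {RV P >-> D})
    (f : {RV pi >-> R}) (b s v eps : R) :
  iid_sample pi X -> (forall x, 0 <= f x <= 1) -> ('E_pi[f] = b%:E)%E ->
  ('V_pi[f] <= s%:E)%E -> 0 < s -> s <= v -> 0 < eps -> (0 < r)%N ->
  1 <= 8^-1 * (eps ^+ 2 / (v + eps)) * r%:R ->
  (P [set w | (eps < `|r%:R^-1 * \sum_(i < r) f (X i w) - b|)%R] <=
   (2 * (s / v) * expR (- (8^-1 * (eps ^+ 2 / (v + eps)) * r%:R)))%:E)%E.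
Proof.
move=> iid f01 Ef Vf s0 sv e0 r0 K1; have v0 : 0 < v by exact: lt_le_trans sv.
have [lambda /ltW l0 hl] := chernoff_exponent s0 sv e0.
set K := _ * r%:R in K1 *.
have mf : measurable_fun setT f by exact: measurable_funP.
have fle1 x : `|f x| <= 1 by have /andP[f0 f1] := f01 x; rewrite ger0_norm.
have ifr : pi.-integrable setT (EFin \o f) by exact: (@integrable_norm_le _ 1).
have ib : pi.-integrable setT (EFin \o (fun _ : D => b)).
  exact: (@integrable_norm_le _ `|b|).
have Ib : (\int[pi]_x b%:E = b%:E)%E.
  by rewrite integral_cst//= probability_setT mule1.
have If : (\int[pi]_x (f x)%:E = b%:E)%E by move: Ef; rewrite unlock.
(* This keeps both [f - b] and [b - f] within [-1, 1], as the one-sided tail bound requires. *)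
have b01 : 0 <= b <= 1.
  rewrite -!lee_fin -If; apply/andP; split.
    by apply: integral_ge0 => x _; rewrite lee_fin; have /andP[] := f01 x.
  have <- : (\int[pi]_x 1%:E = 1%:E)%E.
    by rewrite integral_cst//= probability_setT mule1.
  apply: ge0_le_integral => //.
  - by move=> x _; rewrite lee_fin; have /andP[] := f01 x.
  - exact/measurable_EFinP.
  - by move=> x _; rewrite lee_fin; have /andP[] := f01 x.
have tail (Y : D -> R) : measurable_fun setT Y -> (forall x, `|Y x| <= 1) ->
    (\int[pi]_x (Y x)%:E = 0)%E -> (\int[pi]_x (Y x ^+ 2)%:E <= s%:E)%E ->
    (P [set w | (r%:R * eps < \sum_(i < r) Y (X i w))%R] <=
     (s / v * expR (- K))%:E)%E.
  move=> mY Y1 EY EY2.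
  apply: (le_trans (iid_sum_gt_le eps iid mY Y1 EY EY2 l0)).
  have -> : s / v = expR (- ln (v / s)).
    by rewrite expRN lnK ?posrE ?divr_gt0// invf_div.
  rewrite lee_fin -expRD ler_expR.
  apply: (@le_trans _ _ (- (K * (1 + ln (v / s))))).
    by rewrite /K [in leRHS]mulrAC [in leRHS]mulrC -[leRHS]mulrN ler_wpM2l.
  (* Here [1 <= K] enters: [K * ln (v / s)] is at least [ln (v / s)], which produces the factor
     [s / v]. *)
  have : 0 <= ln (v / s) by rewrite ln_ge0// ler_pdivlMr// mul1r.
  nra.
have EV : (\int[pi]_x ((f x - b) ^+ 2)%:E <= s%:E)%E.
  by move: Vf; rewrite /variance unlock Ef/= unlock.
have tail1 := tail (fun x => f x - b); have tail2 := tail (fun x => b - f x).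
have mYX (Y : D -> R) : measurable_fun setT Y ->
    measurable [set w | (r%:R * eps < \sum_(i < r) Y (X i w))%R].
  move=> mY; rewrite -[X in measurable X]setTI.
  apply: (measurable_fun_ltr (measurable_cst _) (measurable_sum _ _)) => // i.
  by apply: measurableT_comp => //; exact: measurable_funP.
have mfb : measurable_fun setT (fun x => f x - b) by exact: measurable_funB.
have mbf : measurable_fun setT (fun x => b - f x) by exact: measurable_funB.
have sum_f w : \sum_(i < r) (f (X i w) - b) =
    r%:R * (r%:R^-1 * \sum_(i < r) f (X i w) - b).
  rewrite sumrB sumr_const card_ord -[b *+ r]mulr_natl mulrBr mulrA.
  by rewrite divff ?mul1r// pnatr_eq0 -lt0n.
apply: (@le_trans _ _ (P
  ([set w | (r%:R * eps < \sum_(i < r) (f (X i w) - b))%R] `|`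
   [set w | (r%:R * eps < \sum_(i < r) (b - f (X i w)))%R]))).
  apply: le_measure; rewrite ?inE.
  - rewrite -[X in measurable X]setTI.
    apply: (measurable_fun_ltr (measurable_cst _)) => //.
    apply: measurableT_comp => //; apply: measurable_funB => //.
    apply: measurable_funM => //; apply: measurable_sum => i.
    by apply: measurableT_comp => //; exact: measurable_funP.
  - by apply: measurableU; [exact: mYX mfb|exact: mYX mbf].
  - move=> w /=; rewrite ltr_normr => /orP[h|h]; [left|right].
      by rewrite sum_f ltr_pM2l// ltr0n.
    have -> : \sum_(i < r) (b - f (X i w)) = - \sum_(i < r) (f (X i w) - b).
      by rewrite -sumrN; apply: eq_bigr => i _; rewrite opprB.
    by rewrite sum_f -mulrN ltr_pM2l// ltr0n.
apply: (le_trans (measureU2 _ _ _)); [exact: mYX mfb|exact: mYX mbf|].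
have -> : 2 * (s / v) * expR (- K) = s / v * expR (- K) + s / v * expR (- K).
  by ring.
rewrite EFinD; apply: leeD; [apply: tail1 => //|apply: tail2 => //].
- by move=> x; rewrite ler_norml; have := f01 x; lra.
- rewrite (integralB_EFin _ ifr ib)//=.
  by rewrite If Ib subee.
- by move=> x; rewrite ler_norml; have := f01 x; lra.
- rewrite (integralB_EFin _ ib ifr)//=.
  by rewrite If Ib subee.
- by under eq_integral do rewrite -opprB sqrrN.
Qed.

(* Unlike a plain Bernstein bound, this one is proportional to the mean [b], so
   that its sum over a family of functions is controlled by the sum of the
   means instead of the size of the family. *)
Lemma iid_mean_deviation_le_mean (r : nat) (X : 'I_r -> {RV P >-> D})
    (f : {RV pi >-> R}) (b v eps : R) :
  iid_sample pi X -> (forall x, 0 <= f x <= 1) -> ('E_pi[f] = b%:E)%E ->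
  ('V_pi[f] <= v%:E)%E -> 0 < v -> 0 < eps -> (0 < r)%N ->
  1 <= 8^-1 * (eps ^+ 2 / (v + eps)) * r%:R ->
  (P [set w | (eps < `|r%:R^-1 * \sum_(i < r) f (X i w) - b|)%R] <=
   (2 * (b / v) * expR (- (8^-1 * (eps ^+ 2 / (v + eps)) * r%:R)))%:E)%E.
Proof.
move=> iid f01 Ef Vf v0 e0 r0 K1.
have dev s := @iid_mean_deviation_le_variance r X f b s v eps iid f01 Ef.
have Vb := variance_le_mean f01 Ef.
set K := _ * r%:R in K1 dev *.
(* If [v <= b], take [s = v]: the resulting factor 1 is at most [b / v]. If [0 < b < v], take
   [s = b]. *)
have [vb|bv] := leP v b.
  apply: (le_trans (dev v Vf v0 (lexx v) e0 r0 K1)).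
  rewrite lee_fin ler_wpM2r ?expR_ge0// ler_wpM2l//.
  by rewrite divff ?gt_eqF// ler_pdivlMr// mul1r.
have b0 : 0 <= b.
  rewrite -lee_fin -Ef; apply: expectation_ge0 => x.
  by have /andP[] := f01 x.
move: b0; rewrite le_eqVlt => /orP[/eqP b0|b0]; last first.
  exact: dev Vb b0 (ltW bv) e0 r0 K1.
(* For [b = 0] the probability must be shown to vanish, but [s] has to be positive. It is therefore
   bounded by every [e' > 0], with [s] small enough that [2 * (s / v) <= e']. *)
rewrite -[X in 2 * (X / _)]b0 mul0r mulr0 mul0r.
apply/lee_addgt0Pr => e' e'0; rewrite add0e.
pose s := Num.min v (e' * v / 2).
have s0 : 0 < s by rewrite lt_min v0 !mulr_gt0.
have sv : s <= v by rewrite ge_min lexx.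
have Vs : ('V_pi[f] <= s%:E)%E by rewrite (le_trans Vb)// -b0 lee_fin ltW.
apply: (le_trans (dev s Vs s0 sv e0 r0 K1)).
rewrite lee_fin.
have se : 2 * (s / v) <= e'.
  rewrite mulrA ler_pdivrMr// mulrC -ler_pdivlMr//.
  by rewrite /s ge_min lexx orbT.
apply: le_trans se; rewrite ler_piMr//; last by rewrite expR_le1; lra.
by rewrite mulr_ge0// divr_ge0// ltW.
Qed.

End SampleDeviation.

(** * Supremum deviation and the union bound *)

Lemma supremum_deviation_le (R : realType) (d : measure_display)
    (D : measurableType d) (pi : probability D R) (V : finType)
    (f : V -> D -> R) (r : nat) (x : 'I_r -> D) (eps : R) : 0 <= eps ->
  (supremum_deviation pi (range f) x <= eps) <->
  (forall v, `|r%:R^-1 * \sum_(i < r) f v (x i) - fine 'E_pi[f v]| <= eps).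
Proof.
move=> eps0; rewrite /supremum_deviation; set S := [set _ | _ in _].
split=> [supS v|dev].
  apply: le_trans supS; apply: ub_le_sup; last by exists (f v) => //; exists v.
  (* The sum of all deviations, finite because [V] is, bounds the set above, so that [sup] is a
     genuine supremum. *)
  exists (\sum_v `|r%:R^-1 * \sum_(i < r) f v (x i) - fine 'E_pi[f v]|).
  move=> _ [_ [u _ <-] <-]; rewrite (bigD1 u)//= lerDl.
  by apply: sumr_ge0 => i _.
(* For empty [V] the default value [sup set0 = 0] is covered by [0 <= eps]. *)
have [->|/set0P S0] := eqVneq S set0; first by rewrite sup0.
by apply: ge_sup => // _ [_ [v _ <-] <-]; exact: dev.
Qed.

Theorem theorem3 (R : realType) :
  exists C : R, 0 < C /\
  forall (V : finType) (G : temporal_graph V) (star : criterion)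
    (d : measure_display) (D : measurableType d) (pi : probability D R)
    (bt : V -> {RV pi >-> R})
    (bt01 : forall v x, 0 <= bt v x <= 1)
    (bt_unbiased : forall v,
       ('E_pi[bt v] = (temporal_betweenness R G star v)%:E)%E)
    (vhat rho : R)
    (vhat_range : 0 < vhat <= 4^-1) (rho_ge0 : 0 <= rho)
    (var_le : (\big[Order.max/0%R%:E]_(v : V) 'V_pi[bt v] <= vhat%:E)%E)
    (sum_le : \sum_(v : V) temporal_betweenness R G star v <= rho)
    (eps delta : R) (eps01 : 0 < eps < 1) (delta01 : 0 < delta < 1)
    (r : nat) (r_size : C * sample_order vhat rho eps delta <= r%:R)
    (dO : measure_display) (Omega : measurableType dO)
    (P : probability Omega R) (X : 'I_r -> {RV P >-> D})
    (X_iid : iid_sample pi X),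
  ((1 - delta)%:E <=
     P [set w | (supremum_deviation pi (range (fun v : V => bt v : D -> R))
                  (fun i => X i w) <= eps)%R])%E.
Proof.
(* 16 is 8 times 2: the 8 cancels the constant of the exponent, and the 2 leaves [expR (- M)] twice,
   once against [rho / (delta * vhat)] and once against the factor 2 of the two tails. *)
exists 16; split=> // V G star d D pi bt bt01 Ebt vhat rho /andP[v0 _] rho0.
move=> Vbt sumb eps delta /andP[e0 _] /andP[d0 d1] r hr dO Omega P X iid.
set b := temporal_betweenness R G star in Ebt sumb.
have Vv v : ('V_pi[bt v] <= vhat%:E)%E.
  apply: le_trans Vbt; exact: (le_bigmax _ (fun v => 'V_pi[bt v])%E v).
have fineE v : fine 'E_pi[bt v] = b v by rewrite Ebt.
pose M := Num.max 1 (ln (rho / (delta * vhat))).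
have M1 : 1 <= M by rewrite le_max lexx.
pose q := eps ^+ 2 / (vhat + eps).
have q0 : 0 < q by rewrite divr_gt0 ?exprn_gt0// addr_gt0.
have K2 : 2 * M <= 8^-1 * q * r%:R.
  have : 16 * (q^-1 * M) <= r%:R by rewrite /q invf_div.
  move/(ler_wpM2l (ltW q0)); rewrite mulrCA [q * (_ * _)]mulrA.
  rewrite mulfV ?gt_eqF// mul1r; lra.
have r0 : (0 < r)%N.
  by rewrite lt0n; apply/eqP => r0; move: K2; rewrite r0 mulr0; lra.
pose A v := [set w | eps < `|r%:R^-1 * \sum_(i < r) bt v (X i w) - b v|].
have mA v : measurable (A v).
  rewrite -[X in measurable X]setTI.
  apply: (measurable_fun_ltr (measurable_cst _)) => //.
  apply: measurableT_comp => //; apply: measurable_funB => //.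
  apply: measurable_funM => //; apply: measurable_sum => i.
  by apply: measurableT_comp => //; exact: measurable_funP.
pose U := \bigcup_(v in [set: V]) A v.
have mU : measurable U by apply: fin_bigcup_measurable.
have -> : [set w | supremum_deviation pi (range (fun v : V => bt v : D -> R))
    (fun i => X i w) <= eps] = ~` U.
  apply/seteqP; split => w /=.
    move/(supremum_deviation_le _ (fun v : V => bt v : D -> R) _ (ltW e0)).
    move=> dev [v _]; rewrite /A/= ltNge -fineE.
    by rewrite dev.
  move=> NU; apply/(supremum_deviation_le _ _ _ (ltW e0)) => v.
  by rewrite leNgt fineE; apply/negP => Aw; apply: NU; exists v.
rewrite probability_setC// EFinB leeB//.
set E := expR (- (8^-1 * q * r%:R)).
have PA v : (P (A v) <= (2 * (b v / vhat) * E)%:E)%E.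
  apply: iid_mean_deviation_le_mean => //; rewrite -/q; lra.
have PU : (P U <= \sum_(v : V) P (A v))%E.
  have subU : U `<=` \bigcup_(v in [set: V]) A v by [].
  apply: (le_trans (content_sub_fsum P _ (fun v _ => mA v) mU subU)).
    exact: finite_finset.
  rewrite (fsbigE (index_enum V)) ?index_enum_uniq// => [|v _].
    by under eq_bigl do rewrite in_setT.
  by rewrite mem_index_enum.
apply: (le_trans PU).
apply: (@le_trans _ _ (\sum_(v : V) (2 * (b v / vhat) * E)%:E)%E).
  exact: lee_sum.
rewrite sumEFin lee_fin -mulr_suml -mulr_sumr -mulr_suml.
apply: (@le_trans _ _ (2 * (rho / vhat) * E)).
  by rewrite ler_wpM2r ?expR_ge0// ler_wpM2l// ler_wpM2r// invr_ge0 ltW.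
set x := rho / (delta * vhat).
have -> : rho / vhat = delta * x by rewrite /x; field; rewrite !gt_eqF.
have x0 : 0 <= x by rewrite divr_ge0// mulr_ge0// ltW.
have xM : x <= expR M.
  (* [lnK] needs a positive argument, so [rho = 0] is treated apart. *)
  move: x0; rewrite le_eqVlt => /orP[/eqP<-|x0]; first exact: expR_ge0.
  by rewrite -[leLHS](lnK x0) ler_expR /M le_max lexx orbT.
have EM : E <= expR (- M) * expR (- M).
  by rewrite -expRD ler_expR; lra.
have e2 : expR (- M) <= 2^-1.
  rewrite expRN lef_pV2 ?posrE ?expR_gt0//.
  by apply: le_trans (expR_ge1Dx M); lra.
(* One [expR (- M)] cancels [x <= expR M]; the other is at most one half because [1 <= M]. *)
have xE : x * E <= 2^-1.
  apply: (le_trans (ler_pM x0 (expR_ge0 _) xM EM)).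
  by rewrite mulrA expRN mulfV ?expR_eq0// mul1r -expRN.
have -> : 2 * (delta * x) * E = delta * (2 * (x * E)) by ring.
by apply: ler_piMr; [exact: ltW | lra].
Qed.
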